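(* Let $(\bar p,\bar x)\in\mathbb{P}\times\mathbb{X}$. Suppose that: (i) $\bar x\in\mathcal{S}(\bar p)$; (ii) the set-valued mapping $p\mapsto F(p,\bar x)$ is Hausdorff $C$-u.s.c. at $\bar p$; (iii) there exists $\delta_1>0$ such that for every $p\in \mathrm{B}(\bar p,\delta_1)$ the set-valued mapping $x\mapsto F(p,x)$ is l.s.c. on $\mathbb{X}$; (iv) there exists $\delta_2>0$ such that, for every $p\in \mathrm{B}(\bar p,\delta_2)$, the set-valued mapping $x\mapsto F(p,x)$ admits an outer prederivative $H_{F(p,\cdot)}(x;\cdot):\mathbb{X}\rightrightarrows\mathbb{Y}$ at each point $x\in \mathrm{B}(\bar x,\delta_2)$, such that $$\sigma_H(\bar p,\bar x)=\inf\{\sigma_{H_{F(p,\cdot)}}(x)\ |\ (p,x)\in [\mathrm{B}(\bar p,\delta_2)\times \mathrm{B}(\bar x,\delta_2)]\setminus\mathrm{graph}\,\mathcal{S}\}>0.$$ Then there exist positive $\zeta$ and $\eta$ such that, for every $(p,x)\in[\mathrm{int}\,\mathrm{B}(\bar p,\zeta)\times\mathrm{int}\,\mathrm{B}(\bar x,\eta)]\cap\mathrm{graph}\,\mathcal{S}$ and every $x^*\in\mathbb{X}^*$, $$\widehat{\mathrm{D}}^*\mathcal{S}(p,x)(x^* )=\{p^*\in\mathbb{P}^*\ |\ (p^*,-x^* )\in\mathrm{cone}\,\widehat{\partial}\nu_{F,C}(p,x)\}.$$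
   Context: Standing assumptions: $(\mathbb{P},\|\cdot\|)$ and $(\mathbb{Y},\|\cdot\|)$ are normed vector spaces, $(\mathbb{X},\|\cdot\|)$ is a Banach space, $\mathbb{P}\times\mathbb{X}$ carries the max-norm, $C\subset\mathbb{Y}$ is a closed convex cone with $\mathrm{int}\,C\ne\varnothing$, and $F:\mathbb{P}\times\mathbb{X}\rightrightarrows\mathbb{Y}$ is a set-valued mapping with nonempty values everywhere. The solution mapping $\mathcal{S}:\mathbb{P}\rightrightarrows\mathbb{X}$ of the parameterized set-valued inclusion $F(p,x)\subseteq C$ is $\mathcal{S}(p)=\{x\in\mathbb{X}\ |\ F(p,x)\subseteq C\}$; $\mathrm{graph}\,\mathcal{S}=\{(p,x)\ |\ x\in\mathcal{S}(p)\}$. Notation: $\mathrm{B}(x,r)$ is the closed ball with center $x$ and radius $r$; $\mathbb{B}$ is the closed unit ball and $\mathbb{S}$ the unit sphere of the relevant space; $\mathrm{dist}(x,S)=\inf_{z\in S}\|x-z\|$, $\mathrm{B}(S,r)=\{x\ |\ \mathrm{dist}(x,S)\le r\}$; $\inf\varnothing=+\infty$, $\sup\varnothing=-\infty$; $\mathbb{V}^*$ is the topological dual of $\mathbb{V}$; $\mathrm{cone}\,S$ is the conic hull of $S$. The merit function is $\nu_{F,C}(p,x)=\sup_{y\in F(p,x)}\mathrm{dist}(y,C)\in[0,+\infty]$. A set-valued mapping $\Phi$ is l.s.c. at $x_0$ if for every open $V$ with $\Phi(x_0)\cap V\ne\varnothing$ there is a neighbourhood $U$ of $x_0$ with $\Phi(x)\cap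 V\neq\varnothing$ for all $x\in U$. $\Phi$ is Hausdorff $C$-u.s.c. at $x_0$ if for every $\epsilon>0$ there is $\delta>0$ such that $\Phi(x)\subseteq \mathrm{B}(\Phi(x_0)+C,\epsilon)$ for all $x\in \mathrm{B}(x_0,\delta)$. A set-valued mapping $H$ is positively homogeneous if $H(tx)=tH(x)$ for all $t>0$. A positively homogeneous mapping $H_\Phi(x_0;\cdot):\mathbb{X}\rightrightarrows\mathbb{Y}$ is an outer prederivative of $\Phi:\mathbb{X}\rightrightarrows\mathbb{Y}$ at $x_0$ if for every $\epsilon>0$ there is $\delta>0$ such that $\Phi(x)\subseteq \Phi(x_0)+H_\Phi(x_0;x-x_0)+\epsilon\|x-x_0\|\mathbb{B}$ for all $x\in \mathrm{B}(x_0,\delta)$. For $K,S\subseteq\mathbb{Y}$, $K{*\over{}}S=\{y\in\mathbb{Y}\ |\ y+S\subseteq K\}$ and $|K{*\over{}}S|=\sup\{r>0\ |\ r\mathbb{B}\subseteq K{*\over{}}S\}$. Then $\sigma_{H_{F(p,\cdot)}}(x)=\sup_{u\in\mathbb{S}}\,|C{*\over{}}H_{F(p,\cdot)}(x;u)|$, with $u$ ranging over the unit sphere of $\mathbb{X}$. Fréchet subdifferential of $\varphi:\mathbb{V}\to\mathbb{R}\cup\{\pm\infty\}$ at $x_0$ with $\varphi(x_0)\in\mathbb{R}$: $\widehat\partial\varphi(x_0)=\{x^*\in\mathbb{V}^*\ |\ \liminf_{x\to x_0}\frac{\varphi(x)-\varphi(x_0)-\langle x^*,x-x_0\rangle}{\|x-x_0\|}\ge0\}$.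 Fréchet normal cone to $S\subseteq\mathbb{P}\times\mathbb{X}$ at $w_0\in S$: $\widehat{\mathrm N}(S;w_0)=\{w^*\in\mathbb{P}^*\times\mathbb{X}^*\ |\ \limsup_{S\ni w\to w_0}\frac{\langle w^*,w-w_0\rangle}{\|w-w_0\|}\le0\}$. Fréchet coderivative of $\mathcal{S}$ at $(p,x)\in\mathrm{graph}\,\mathcal{S}$: $\widehat{\mathrm D}^*\mathcal{S}(p,x):\mathbb{X}^*\rightrightarrows\mathbb{P}^*$, $\widehat{\mathrm D}^*\mathcal{S}(p,x)(x^* )=\{p^*\in\mathbb{P}^*\ |\ (p^*,-x^* )\in\widehat{\mathrm N}(\mathrm{graph}\,\mathcal{S};(p,x))\}$. *)

(* Defs.v *)
From HB Require Import structures.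
From mathcomp Require Import all_boot all_order all_algebra.
From mathcomp Require Import all_classical all_reals all_analysis.

Set Implicit Arguments.
Unset Strict Implicit.
Unset Printing Implicit Defensive.

Import Order.TTheory GRing.Theory Num.Theory.
Import numFieldNormedType.Exports.

Local Open Scope classical_set_scope.
Local Open Scope ring_scope.

Section SetOperations.
Context {R : realType} {V : normedModType R}.
Implicit Types (x : V) (A K S : set V).

Definition minkowski_sum A S : set V := [set a + s | a in A & s in S].

Definition scale_set (t : R) A : set V := [set t *: a | a in A].

Definition unit_ball : set V := closed_ball (0 : V) 1.

Definition unit_sphere : set V := [set u | `|u| = 1].

(* [dist x set0 = +oo] *)
Definition dist x S : \bar R := ereal_inf [set `|x - z|%:E | z in S].

Definition enlargement S (r : R) : set V := [set x | (dist x S <= r%:E)%E].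

Definition star_difference K S : set V := [set y | [set y + s | s in S] `<=` K].

(* The value is [-oo] if [A] contains no ball centered at the origin. *)
Definition inner_radius A : \bar R :=
  ereal_sup [set r%:E | r in [set r : R | 0 < r /\ scale_set r unit_ball `<=` A]].

End SetOperations.

Section Cones.
Context {R : realType} {V : lmodType R}.

Definition is_cone (K : set V) : Prop :=
  forall (t : R) (x : V), 0 <= t -> K x -> K (t *: x).

Definition conic_hull (S : set V) : set V :=
  [set t *: s | t in [set t : R | 0 <= t] & s in S].

End Cones.

Section SetValuedMappings.
Context {R : realType}.

Definition graph {U V : Type} (Phi : U -> set V) : set (U * V) :=
  [set w | Phi w.1 w.2].

Definition lsc_at {U V : normedModType R} (Phi : U -> set V) (x0 : U) : Prop :=
  forall O : set V, open O -> Phi x0 `&` O !=set0 ->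
    \forall x \near x0, Phi x `&` O !=set0.

Definition hausdorff_usc_at {U V : normedModType R} (C : set V)
    (Phi : U -> set V) (x0 : U) : Prop :=
  forall eps : R, 0 < eps -> exists2 delta : R, 0 < delta &
    forall x, closed_ball x0 delta x ->
      Phi x `<=` enlargement (minkowski_sum (Phi x0) C) eps.

Definition positively_homogeneous {U V : normedModType R}
    (H : U -> set V) : Prop :=
  forall (t : R) (x : U), 0 < t -> H (t *: x) = scale_set t (H x).

Definition outer_prederivative {U V : normedModType R} (Phi : U -> set V)
    (x0 : U) (H : U -> set V) : Prop :=
  positively_homogeneous H /\
  forall eps : R, 0 < eps -> exists2 delta : R, 0 < delta &
    forall x, closed_ball x0 delta x ->
      Phi x `<=` minkowski_sum (minkowski_sum (Phi x0) (H (x - x0)))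
                               (scale_set (eps * `|x - x0|) unit_ball).

Definition sigma {U V : normedModType R} (C : set V) (H : U -> set V) : \bar R :=
  ereal_sup [set inner_radius (star_difference C (H u)) | u in unit_sphere].

End SetValuedMappings.

Section Inclusion.
Context {R : realType} {P X Y : normedModType R}.
Variables (F : P -> X -> set Y) (C : set Y).

Definition sol (p : P) : set X := [set x | F p x `<=` C].

Definition merit (w : P * X) : \bar R :=
  ereal_sup [set dist y C | y in F w.1 w.2].

End Inclusion.

(* The topological dual is a set of functions [V -> R^o], so that the
   operations on functionals are the pointwise ones. *)
Definition dual {R : realType} (V : normedModType R) : set (V -> R^o) :=
  [set f | linear f /\ continuous f].
Arguments dual {R} V _.

Section Subdifferential.
Context {R : realType}.

(* Limits use punctured neighborhoods, since the quotients are meaningful only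
   for [x != x0]. *)
Definition frechet_subdiff {V : normedModType R} (phi : V -> \bar R) (x0 : V) :
    set (V -> R^o) :=
  [set f | [/\ phi x0 \is a fin_num, dual V f &
    (0 <= limf_einf
       (fun x : V => (phi x - phi x0 - (f (x - x0))%:E) * (`|x - x0|^-1)%:E)
       (dnbhs x0))%E]].

Definition frechet_normal {V : normedModType R} (S : set V) (w0 : V) :
    set (V -> R^o) :=
  [set f | dual V f /\
    (limf_esup (fun w : V => (f (w - w0) / `|w - w0|)%:E)
       (within S (dnbhs w0)) <= 0)%E].

(* The identification of the product of the duals with the dual of the
   product. *)
Definition dual_pair {U V : normedModType R} (f : U -> R^o) (g : V -> R^o) :
  U * V -> R^o := fun w => f w.1 + g w.2.

Definition frechet_coderivative {U V : normedModType R} (Phi : U -> set V)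
    (p : U) (x : V) (xs : V -> R^o) : set (U -> R^o) :=
  [set ps | dual U ps /\
            frechet_normal (graph Phi) (p, x) (dual_pair ps (- xs))].

End Subdifferential.

(* Main.v *)
Require Import Defs.
From HB Require Import structures.
From mathcomp Require Import all_boot all_order all_algebra.
From mathcomp Require Import all_classical all_reals all_analysis.
From mathcomp Require Import ring lra.
Import Order.TTheory GRing.Theory Num.Theory.
Import numFieldNormedType.Exports.
Local Open Scope classical_set_scope.
Local Open Scope ring_scope.

(** Near [(pbar, xbar)] the merit function [merit F C] vanishes exactly on the
graph of the solution mapping and satisfies an error bound there: for some
[s > 0], a pair [(p, x)] of small merit has a solution [v] of the inclusion
with the same [p] and [s * `|x - v| <= merit F C (p, x)].  The identity between
the Fréchet normal cone to the graph and the cone generated by the Fréchet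
subdifferential of the merit function is a consequence of this bound.

The error bound comes from Ekeland's principle.  If [x] does not solve the
inclusion, then [s < sigma C (H p x)] yields a unit direction [u] and a radius
[r > s] such that [H p x u] stays in [C] after any translation of norm at most
[r].  A step of length [t] along [u] therefore brings the values of [F p] closer
to [C] by [r * t], up to the error [(r - s) * t] of the prederivative
([outer_prederivative_decrease]), so the merit drops by at least [s * t].  As
the merit function is lower semicontinuous in [x] ([merit_lsc]) and [X] is
complete, [ekeland] gives a point within the announced distance where no such
drop is possible, hence a solution ([error_bound], [sol_error_bound]).

For the normal cone ([frechet_normal_error_bound]), let [f] be a normal to the
set [S] of zeros of [phi] at [w0], with [`|f v| <= K * `|v|].  A point [w] near
[w0] is compared with a point [v] of [S] provided by the error bound: the
definition of a normal controls [f (v - w0)], while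
[f (w - v) <= K * `|w - v| <= K / s * phi w].  So [f], divided by [(K + 1) / s],
is a subgradient.  Only those [w] matter where [phi w] is at most a multiple of
[`|w - w0|], since elsewhere the subgradient inequality is clear; this is why a
bound valid for points of small merit suffices.  The converse inclusion holds
because [phi] vanishes on [S]. *)

(** * Distance to a convex cone *)

Section Distance.
Context {R : realType} {V : normedModType R}.
Implicit Types (x y h : V) (S C : set V) (a e r t : R).

(** Upper bounds of a distance are only ever used through nearby points of the
set; stated this way they make sense for an empty [S] as well, where the
distance is infinite. *)
Lemma dist_leP x S a :
  (dist x S <= a%:E)%E <->
  forall e, 0 < e -> exists2 z, S z & `|x - z| < a + e.
Proof.
split=> [xa e e0|xa].
  have : (dist x S < (a + e)%:E)%E by rewrite (le_lt_trans xa)// lte_fin ltrDl.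
  by move=> /ereal_inf_lt[_ [z Sz <-]]; rewrite lte_fin; exists z.
apply/lee_addgt0Pr => e /xa[z Sz xz]; apply: ereal_inf_le.
by exists `|x - z|%:E; [exists z|rewrite lee_fin ltW].
Qed.

Lemma dist_ge0 x S : (0 <= dist x S)%E.
Proof. by apply: le_ereal_inf_tmp => _ [z _ <-]; rewrite lee_fin. Qed.

Lemma dist_le_perturb x y S a e :
  (dist x S <= a%:E)%E -> `|y - x| <= e -> (dist y S <= (a + e)%:E)%E.
Proof.
move=> /dist_leP xa yx; apply/dist_leP => d /xa[z Sz xz]; exists z => //.
rewrite -(subrKA x) (le_lt_trans (ler_normD _ _))//; lra.
Qed.

Lemma dist_le0 x S : closed S -> (dist x S <= 0)%E -> S x.
Proof.
move=> clS /dist_leP x0; apply: clS => A /nbhs_ballP[e /= e0 eA].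
have [z Sz xz] := x0 _ e0; exists z; split => //; apply: eA.
by rewrite -ball_normE /= -[e]add0r.
Qed.

Lemma convex_cone_add C : convex_set C -> is_cone C ->
  forall x y, C x -> C y -> C (x + y).
Proof.
move=> Ccv Cc x y Cx Cy.

have h0 : 0 <= 2^-1 :> R by lra.
have h1 : 2^-1 <= 1 :> R by lra.
have := @Ccv (2 *: x) (2 *: y) (Itv01 h0 h1).
rewrite !inE => /(_ (Cc _ _ (ler0n _ 2) Cx) (Cc _ _ (ler0n _ 2) Cy)).
rewrite /conv /= !scalerA mulVf// scale1r.
have -> : unstable.onem (2^-1) = 2^-1 :> R by rewrite /unstable.onem; lra.
by rewrite mulVf// scale1r.
Qed.

(** If a point [z] of the cone nearly realizes the distance to [x], it can be
moved by [t *: (k *: (x - z) + h)] inside the cone as long as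
[k * `|x - z| <= r]: the summand along [x - z] is what makes up for the distance,
by the amount [r * t], or reaches [x + t *: h] itself when [x] is closer than
that. *)
Lemma dist_le_inner_shift C x h a r t :
  convex_set C -> is_cone C -> (forall v, `|v| <= r -> C (v + h)) ->
  0 < r -> 0 < t -> r * t <= a -> (dist x C <= a%:E)%E ->
  (dist (x + t *: h)%R C <= (a - r * t)%:E)%E.
Proof.
move=> Ccv Cc rC r0 t0 rta /dist_leP xa; apply/dist_leP => e e0.
have [z Cz xz] := xa _ e0; set w := x - z in xz.
have Cshift k : 0 <= k -> k * `|w| <= r -> C (z + t *: (k *: w + h)).
  move=> k0 kw; apply: convex_cone_add => //; apply: Cc; first exact: ltW.
  by apply: rC; rewrite normrZ ger0_norm.
have [wrt|rtw] := leP `|w| (r * t).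
  exists (z + t *: (t^-1 *: w + h)).
    by apply: Cshift; [rewrite invr_ge0 ltW|rewrite mulrC ler_pdivrMr].
  have -> : z + t *: (t^-1 *: w + h) = x + t *: h.
    by rewrite scalerDr scalerA mulfV ?gt_eqF// scale1r addrA [z + w]addrC subrK.
  by rewrite subrr normr0; lra.
have w0 : 0 < `|w| by rewrite (lt_trans _ rtw)// mulr_gt0.
exists (z + t *: ((r / `|w|) *: w + h)).
  by apply: Cshift; [rewrite divr_ge0// ltW|rewrite divfK ?gt_eqF].
have -> : x + t *: h - (z + t *: ((r / `|w|) *: w + h)) =
          (1 - r * t / `|w|) *: w.
  have -> : x = z + w by rewrite /w addrC subrK.
  rewrite scalerDr scalerA -[z + w + _]addrA opprD addrACA subrr add0r.
  rewrite opprD addrACA subrr addr0 scalerBl scale1r.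
  by rewrite mulrCA mulrA.
rewrite normrZ ger0_norm; last by rewrite subr_ge0 ler_pdivrMr// mul1r ltW.
rewrite mulrBl mul1r divfK ?gt_eqF//; lra.
Qed.

Lemma scale_unit_ball r x : 0 < r -> scale_set r unit_ball x <-> `|x| <= r.
Proof.
move=> r0; rewrite /scale_set /unit_ball closed_ballE//; split=> /= [[b]|xr].
  rewrite /closed_ball_ /= sub0r normrN => b1 <-.
  by rewrite normrZ gtr0_norm// ler_piMr// ltW.
exists (r^-1 *: x); last by rewrite scalerA mulfV ?gt_eqF// scale1r.
rewrite /closed_ball_ /= sub0r normrN normrZ gtr0_norm ?invr_gt0//.
by rewrite mulrC ler_pdivrMr// mul1r.
Qed.

End Distance.

Lemma merit_leP {R : realType} {P X Y : normedModType R} (F : P -> X -> set Y)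
    (C : set Y) w (a : \bar R) :
  (merit F C w <= a)%E <-> forall y, F w.1 w.2 y -> (dist y C <= a)%E.
Proof.
split=> [wa y Fy|h]; last by apply: ge_ereal_sup => _ [y Fy <-]; exact: h.
by apply: le_trans wa; apply: ereal_sup_ubound; exists y.
Qed.

(** * Decrease of the distance along a prederivative *)

Section Decrease.
Context {R : realType} {U V : normedModType R}.

(** The direction [u] is taken from the supremum that defines [sigma], with a
radius [r > s]; the prederivative is used with error [r - s], so that the gain
[r * t] given by [dist_le_inner_shift] leaves [s * t]. *)
Lemma outer_prederivative_decrease (C : set V) (Phi : U -> set V) (x : U)
    (H : U -> set V) (s a : R) :
  convex_set C -> is_cone C -> outer_prederivative Phi x H ->
  0 < s -> (s%:E < sigma C H)%E -> 0 < a ->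
  (forall y, Phi x y -> (dist y C <= a%:E)%E) ->
  exists2 v, v != x &
    forall y, Phi v y -> (dist y C <= (a - s * `|x - v|)%:E)%E.
Proof.
move=> Ccv Cc [Hhom Hout] s0 /ereal_sup_gt[_ [u u1 <-]].
move=> /ereal_sup_gt[_ [r [r0 rC] <-]]; rewrite lte_fin => sr a0 xa.
have [d d0 Hd] := Hout (r - s) ltac:(lra).
(* [t <= a / r]: the distance cannot decrease below zero. *)
pose t := Num.min d (a / r).
have t0 : 0 < t by rewrite lt_min d0 divr_gt0.
have rta : r * t <= a.
  by rewrite mulrC -ler_pdivlMr// ge_min lexx orbT.
have tu : `|t *: u| = t by rewrite normrZ u1 mulr1 gtr0_norm.
exists (x + t *: u).
  by rewrite -subr_eq0 addrAC subrr add0r -normr_eq0 tu gt_eqF.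
have -> : `|x - (x + t *: u)| = t by rewrite opprD addNKr normrN.
move=> y; have /Hd/[apply] : closed_ball x d (x + t *: u).
  by rewrite closed_ballE// /closed_ball_ /= opprD addNKr normrN tu ge_min lexx.
have -> : x + t *: u - x = t *: u by rewrite addrAC subrr add0r.
rewrite tu Hhom// => -[_ [y0 Fy0 [_ [h Hh <-] <-]]] [b].
have et0 : 0 < (r - s) * t by rewrite mulr_gt0//; lra.
move=> /(scale_unit_ball _ _ et0).1 bt <-.
have -> : a - s * t = a - r * t + (r - s) * t by ring.
apply: (@dist_le_perturb _ _ (y0 + t *: h)); last by rewrite addrC addKr.
apply: dist_le_inner_shift => //; last exact: xa.
by move=> v vr; have /rC := (scale_unit_ball _ v r0).2 vr; apply; exists h.
Qed.

End Decrease.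

(** * Ekeland's principle and error bounds *)

Section ErrorBound.
Context {R : realType} {X : completeNormedModType R}.
Variables (phi : X -> \bar R) (c : R).
Hypotheses (c0 : 0 < c) (phi0 : forall x, (0 <= phi x)%E).
Hypothesis phi_lsc : lower_semicontinuous phi.

(** The points at which [phi] is smaller than at [x] by at least [c] times the
distance: [T] is the order of Ekeland's principle. *)
Let T (x : X) : set X := [set v | (phi v + (c * `|x - v|)%:E <= phi x)%E].

Let T_refl x : T x x.
Proof. by rewrite /T /= subrr normr0 mulr0 adde0. Qed.

Let T_trans x v w : T x v -> T v w -> T x w.
Proof.
rewrite /T /= => xv vw; apply: le_trans xv.
apply: le_trans (leeD2r _ vw).
rewrite -addeA leeD2l// -EFinD lee_fin -mulrDr ler_pM2l//.
by rewrite [leRHS]addrC ler_distD.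
Qed.

Let T_fin x v : phi x \is a fin_num -> T x v ->
  phi v \is a fin_num /\ c * `|x - v| <= fine (phi x) - fine (phi v).
Proof.
move=> xfin xv.
have vfin : phi v \is a fin_num.
  rewrite ge0_fin_numE// (le_lt_trans _ (ltry (fine (phi x))))//.
  rewrite fineK// (le_trans _ xv)// leeDl// lee_fin mulr_ge0// ltW//.
split => //; move: xv; rewrite /T /= -(fineK xfin) -(fineK vfin) -EFinD lee_fin /=.
lra.
Qed.

Let T_closed x : phi x \is a fin_num -> closed (T x).
Proof.
move=> xfin; rewrite -openC openE => v /= /negP; rewrite -ltNge.
rewrite -(fineK xfin) -lteBlDr// -EFinB => xv.
have [e e0 ev] : exists2 e, 0 < e &
    ((fine (phi x) - c * `|x - v| + c * e)%:E < phi v)%E.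
  case: (phi v) xv => [r||//].
    rewrite lte_fin => xr; pose d := r - (fine (phi x) - c * `|x - v|).
    have d0 : 0 < d by rewrite /d; lra.
    exists (d / 2 / c); first by rewrite !divr_gt0.
    by rewrite lte_fin [c * (_ / c)]mulrC divfK ?gt_eqF// /d; rewrite /d in d0; lra.
  by move=> _; exists 1; rewrite // ltry.
have [W Wv Wphi] := phi_lsc _ _ ev.

apply: filterS (filterI Wv (nbhsx_ballx v _ e0)) => w [/Wphi wphi].
rewrite -ball_normE /= => vw; apply/negP; rewrite -ltNge -(fineK xfin).
rewrite -lteBlDr// -EFinB (le_lt_trans _ wphi)// lee_fin.
have := ler_distD w x v; rewrite (distrC w v) => xvw.
have : c * `|x - v| <= c * `|x - w| + c * e.
  by rewrite -mulrDr ler_pM2l// (le_trans xvw)// lerD2l ltW.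
lra.
Qed.

(** A minimal point below [x0] is the limit of a sequence in which each term is a
successor of the previous one, at least half as far from it as any other
successor.  Along the sequence [phi] decreases and is bounded below, so the steps
tend to zero, and with them the size of the sets [T (u n)]; their common point is
the limit. *)
Lemma ekeland x0 : phi x0 \is a fin_num ->
  exists2 v, (phi v + (c * `|x0 - v|)%:E <= phi x0)%E &
    forall w, (phi w + (c * `|v - w|)%:E <= phi v)%E -> w = v.
Proof.
move=> x0fin.
pose step x y := T x y /\
  (phi x \is a fin_num -> forall v, T x v -> `|x - v| <= 2 * `|x - y|).
have stepex x : {y | step x y}.
  apply: cid; have [xfin|xinf] := pselect (phi x \is a fin_num); last first.
    by exists x; split.
  pose D := [set `|x - v| | v in T x].
  have D0 : D 0 by exists x; rewrite ?subrr ?normr0.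
  have Dsup : has_sup D.
    split; first by exists 0.
    exists (fine (phi x) / c) => _ [v /(T_fin _ _ xfin)[vfin xv] <-].
    rewrite ler_pdivlMr// mulrC (le_trans xv)// gerBl fine_ge0//.
  have [s0|s0] := leP (sup D) 0.
    exists x; split=> // _ v xv; rewrite subrr normr0 mulr0 (le_trans _ s0)//.
    by apply: sup_upper_bound => //; exists v.
  have [_ [y xy <-] sy] := @sup_adherent _ D (sup D / 2) ltac:(lra) Dsup.
  exists y; split=> // _ v xv; apply: (@le_trans _ _ (sup D)); last lra.
  by apply: sup_upper_bound => //; exists v.
have [u [u0 ustep]] := dependent_choice stepex x0.
have uT n m : (n <= m)%N -> T (u n) (u m).
  elim: m => [|m IH]; first by rewrite leqn0 => /eqP ->.
  rewrite leq_eqVlt => /predU1P[->//|nm].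
  exact: T_trans (IH nm) (ustep m).1.
have ufin n : phi (u n) \is a fin_num.
  by have := T_fin _ _ x0fin; rewrite -u0 => /(_ (u n) (uT _ _ (leq0n n)))[].
pose rho n := fine (phi (u n)).
have rho_cvg : cvgn rho.
  apply: nonincreasing_is_cvgn.
    move=> n m /uT /(T_fin _ _ (ufin n))[_]; rewrite -/(rho n) -/(rho m) => h.
    by rewrite -subr_ge0 (le_trans _ h)// mulr_ge0// ltW.
  by exists 0 => _ [n _ <-]; apply: fine_ge0.
have usmall e : 0 < e -> exists n, forall v, T (u n) v -> `|u n - v| < e.
  move=> e0.
  have rhoc : rho n - rho n.+1 @[n --> \oo] --> limn rho - limn rho.
    by apply: cvgB => //; rewrite cvg_shiftS.
  have ce0 : 0 < c * (e / 2) by rewrite mulr_gt0// divr_gt0.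
  move: rhoc; rewrite subrr => /cvgrPdist_lt/(_ _ ce0)[n _ /(_ n (leqnn n))] /=.
  rewrite sub0r normrN => nsmall; exists n => v uv.
  have [Tn] := ustep n; move=> /(_ (ufin n) _ uv) /le_lt_trans; apply.
  have [_ cn] := T_fin _ _ (ufin n) Tn.
  rewrite mulrC -ltr_pdivlMr// -(ltr_pM2l c0) (le_lt_trans cn)//.
  exact: le_lt_trans (ler_norm _) nsmall.
have /cauchy_cvgP ucvg : cauchy (u @ \oo).
  apply: cauchy_exP => e /usmall[n un]; exists (u n).
  exists n => // m /= /uT /un; by rewrite -ball_normE.
set v := lim (u @ \oo) in ucvg *.
have uv n : T (u n) v.
  apply: (closed_cvg (T (u n)) (T_closed _ (ufin n)) _ _ ucvg).
  by exists n => // m /=; exact: uT.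
exists v; first by have := uv 0; rewrite u0.
move=> w vw; apply/eqP; rewrite -subr_eq0 -normr_eq0; apply/negPn/negP => wv.
have e0 : 0 < `|w - v| / 2 by rewrite divr_gt0// lt_neqAle eq_sym wv /=.
have [n un] := usmall _ e0.
have := ler_distD (u n) w v; rewrite (distrC w (u n)).
have := un _ (uv n); have := un _ (T_trans _ _ _ (uv n) vw); lra.
Qed.

(** The minimal point of [ekeland] cannot have a positive value of [phi], since
that value could still be lowered. *)
Lemma error_bound x0 a : (phi x0 <= a%:E)%E ->
  (forall v r, c * `|x0 - v| <= a -> 0 < r -> phi v = r%:E ->
     exists2 w, w != v & (phi w <= (r - c * `|v - w|)%:E)%E) ->
  exists2 v, phi v = 0%E & c * `|x0 - v| <= a.
Proof.
move=> x0a dec.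
have x0fin : phi x0 \is a fin_num.
  by rewrite ge0_fin_numE// (le_lt_trans x0a) ?ltry.
have [v Tv vmin] := ekeland _ x0fin.
have [vfin vle] := T_fin _ _ x0fin Tv.
have va : c * `|x0 - v| <= a.
  have : fine (phi x0) <= a by rewrite -lee_fin fineK.
  by have := fine_ge0 (phi0 v); lra.
exists v => //; apply/eqP; apply/negPn/negP => v0.
have /dec : 0 < fine (phi v) by rewrite fine_gt0// lt_neqAle eq_sym v0 phi0 ltey_eq vfin.
move=> /(_ v va); rewrite fineK// => /(_ erefl)[w wv wle].
move/eqP: wv; apply; apply: vmin.
by rewrite -leeBrDr// -(fineK vfin) -EFinB.
Qed.

End ErrorBound.

(** * Fréchet subgradients and normals *)

Section Frechet.
Context {R : realType} {V : normedModType R}.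

Lemma limf_esup_le0 (f : V -> \bar R) (F : set_system V) {FF : Filter F} :
  (limf_esup f F <= 0)%E <->
  forall e, 0 < e -> \forall x \near F, (f x <= e%:E)%E.
Proof.
rewrite limf_esupE; split=> [f0 e e0|f0].
  have /ereal_inf_lt[_ [A FA <-] Ae] := @le_lt_trans _ _ _ _ e%:E f0 e0.
  apply: filterS FA => x Ax; apply: le_trans (ltW Ae).
  by apply: ereal_sup_ubound; exists x.
apply/lee_addgt0Pr => e /f0 fe; rewrite add0e; apply: ereal_inf_le.
exists (ereal_sup (f @` [set x | (f x <= e%:E)%E])); first by eexists; [exact: fe|].
by apply: ge_ereal_sup => _ [x xe <-].
Qed.

(** The inequalities below hold trivially at the base point, so the punctured
neighborhoods in the definitions can be filled in. *)
Lemma near_dnbhs (x0 : V) (A : set V) : A x0 ->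
  (\forall x \near dnbhs x0, A x) <-> (\forall x \near x0, A x).
Proof.
move=> Ax0; rewrite /dnbhs near_withinE; split; apply: filterS => x //.
by have [->|xx0] := eqVneq x x0; last exact.
Qed.

Lemma dual_at0 (f : V -> R^o) : dual V f -> f 0 = 0.
Proof. by move=> [/(_ (-1) 0 0)]; rewrite scaler0 addr0 scaleN1r addNr. Qed.

Lemma frechet_subdiffP (phi : V -> \bar R) x0 (f : V -> R^o) :
  phi x0 = 0%E ->
  frechet_subdiff phi x0 f <-> dual V f /\
  forall e, 0 < e -> \forall x \near x0,
    ((f (x - x0) - e * `|x - x0|)%:E <= phi x)%E.
Proof.
move=> px0.
have quotE x e : x != x0 ->
    (- ((phi x - phi x0 - (f (x - x0))%:E) * (`|x - x0|^-1)%:E) <= e%:E)%E =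
    ((f (x - x0) - e * `|x - x0|)%:E <= phi x)%E.
  move=> xx0; have n0 : 0 < `|x - x0| by rewrite normr_gt0 subr_eq0.
  rewrite px0 sube0; case: (phi x) => [r||].
  - rewrite -EFinB -EFinM -EFinN !lee_fin -mulNr ler_pdivrMr//.
    by apply/idP/idP => ?; lra.
  - by rewrite addye// gt0_mulye ?lte_fin ?invr_gt0// leNye leey.
  - by rewrite addNye// gt0_mulNye ?lte_fin ?invr_gt0//.
have x0E e : dual V f -> ((f (x0 - x0) - e * `|x0 - x0|)%:E <= phi x0)%E.
  by move=> df; rewrite subrr (dual_at0 _ df) normr0 mulr0 subr0 px0.
have einfP : (0 <= limf_einf (fun x : V =>
      (phi x - phi x0 - (f (x - x0))%:E) * (`|x - x0|^-1)%:E) (dnbhs x0))%E <->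
    forall e, 0 < e -> \forall x \near dnbhs x0,
      ((f (x - x0) - e * `|x - x0|)%:E <= phi x)%E.
  rewrite oppe_ge0; split.
    move=> /limf_esup_le0 q0 e /q0; rewrite /dnbhs !near_withinE.
    by apply: filterS => x h xx0; rewrite -quotE//; exact: h.
  move=> h; apply/limf_esup_le0 => e /h; rewrite /dnbhs !near_withinE.
  by apply: filterS => x {}h xx0; rewrite quotE//; exact: h.
split=> [[_ df /einfP q0]|[df q0]].
  by split=> // e /q0 /near_dnbhs; apply; exact: x0E.
split; [by rewrite px0|by []|apply/einfP => e /q0 h].
by apply/near_dnbhs => //; exact: x0E.
Qed.

Lemma frechet_normalP (S : set V) x0 (f : V -> R^o) :
  frechet_normal S x0 f <-> dual V f /\
  forall e, 0 < e -> \forall x \near x0, S x -> f (x - x0) <= e * `|x - x0|.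
Proof.
have x0E e : dual V f -> S x0 -> f (x0 - x0) <= e * `|x0 - x0|.
  by move=> df _; rewrite subrr (dual_at0 _ df) normr0 mulr0.
have quotE x e : x != x0 ->
    ((f (x - x0) / `|x - x0|)%:E <= e%:E)%E = (f (x - x0) <= e * `|x - x0|).
  by move=> xx0; rewrite lee_fin ler_pdivrMr// normr_gt0 subr_eq0.
split=> -[df q0]; split=> //.
  move/limf_esup_le0 : q0 => q0 e /q0; rewrite near_withinE => h.
  apply/(near_dnbhs _ (fun x => S x -> f (x - x0) <= e * `|x - x0|)).
    exact: x0E.
  move: h; rewrite /dnbhs !near_withinE; apply: filterS => x h xx0.
  by rewrite -quotE//; exact: h.
apply/limf_esup_le0 => e /q0; rewrite /dnbhs !near_withinE.
by apply: filterS => x h xx0 Sx; rewrite quotE//; exact: h.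
Qed.

Lemma dual_bounded (f : V -> R^o) : dual V f ->
  exists2 K, 0 < K & forall v, `|f v| <= K * `|v|.
Proof.
move=> df; have [flin fcont] := df; have f0 := dual_at0 _ df.
have /cvgrPdist_lt/(_ 1 ltr01)/nbhs_ballP[d /= d0 fd] := fcont 0.
exists (2 / d) => [|v]; first by rewrite divr_gt0.
have [->|v0] := eqVneq v 0; first by rewrite f0 !normr0 mulr0.
have nv : 0 < `|v| by rewrite normr_gt0.
pose k := d / 2 / `|v|.
have k0 : 0 < k by rewrite !divr_gt0.
have /fd : ball 0 d (k *: v).
  rewrite -ball_normE /= sub0r normrN normrZ gtr0_norm// divfK ?gt_eqF//; lra.
rewrite /= f0 sub0r normrN.
have -> : f (k *: v) = k * f v by have := flin k v 0; rewrite !addr0 f0 addr0.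
rewrite normrM gtr0_norm// mulrC -ltr_pdivlMr// => /ltW /le_trans; apply.
by rewrite /k !invfM !invrK mul1r [2 / d]mulrC.
Qed.

Lemma dual_scale (f : V -> R^o) (k : R) : dual V f -> dual V (k *: f).
Proof.
move=> [flin fcont]; split.
  move=> a u v; rewrite /= !fctE flin scalerDr scalerA mulrC -scalerA.
  by [].
by move=> x; apply: cvgZr; exact: fcont.
Qed.

End Frechet.

(** An error bound turns [phi] into a substitute for the distance to [S], for
which the normal cone is the cone generated by the subdifferential. *)
Lemma frechet_normal_error_bound {R : realType} {W : normedModType R}
    (S : set W) (phi : W -> \bar R) (w0 : W) (s rho : R) :
  (forall w, (0 <= phi w)%E) -> (forall w, S w -> phi w = 0%E) -> S w0 ->
  0 < s -> 0 < rho ->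
  (forall w a, `|w - w0| < rho -> a < rho -> (phi w <= a%:E)%E ->
     exists2 v, S v & s * `|w - v| <= a) ->
  frechet_normal S w0 = conic_hull (frechet_subdiff phi w0).
Proof.
move=> phi0 phiS Sw0 s0 rho0 eb; apply/seteqP; split=> f; last first.
  move=> [t /= t0 [g /(frechet_subdiffP _ _ _ (phiS _ Sw0))[dg gphi] <-]].
  apply/frechet_normalP; split; first exact: dual_scale.
  move=> e e0; have : 0 < e / (t + 1) by rewrite divr_gt0// ltr_wpDl.
  move=> /gphi; apply: filterS => w + Sw; rewrite phiS// lee_fin subr_le0 => gw.
  rewrite !fctE (le_trans (ler_wpM2l t0 gw))// mulrA ler_wpM2r//.
  by rewrite mulrA ler_pdivrMr ?ltr_wpDl// mulrC ler_pM2l//; lra.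
move=> /frechet_normalP[df fS].
have [K K0 fK] := dual_bounded _ df.
(* In [K + 1], [K] pays for [f (w - v)] and [1] for the part [`|w - v|] of the
   error [e1 * `|v - w0|] in the normality of [f], where [e1 <= 1]. *)
pose t := (K + 1) / s.
have t0 : 0 < t by rewrite divr_gt0// addr_gt0.
exists t; first exact: ltW.
exists (t^-1 *: f); last by rewrite scalerA mulfV ?gt_eqF// scale1r.
apply/(frechet_subdiffP _ _ _ (phiS _ Sw0)); split; first exact: dual_scale.
move=> e e0; pose e1 := Num.min 1 (t * e).
have e10 : 0 < e1 by rewrite lt_min ltr01 mulr_gt0.
have /nbhs_ballP[d /= d0 dS] := fS _ e10.
have r0 : 0 < Num.min (d / 2) (Num.min rho (rho / s)).
  by rewrite !lt_min rho0 !divr_gt0.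
(* The estimates below give [phi w <= s * `|w - w0|] when the subgradient
   inequality fails; then [v] is within [2 * `|w - w0|] of [w0], whence [d / 2],
   and [phi w] is below [rho], whence [rho / s]. *)
apply/nbhs_ballP; exists (Num.min (d / 2) (Num.min rho (rho / s))) => //= w.
rewrite -ball_normE /= distrC !lt_min => /and3P[wd wrho wrhos].
set n := `|w - w0| in wd wrho wrhos *.
have n0 : 0 <= n := normr_ge0 _.
rewrite leNgt; apply/negP => phiw.
have [r phir] : exists r, phi w = r%:E.
  exists (fine (phi w)); rewrite fineK// ge0_fin_numE//.
  by rewrite (lt_trans phiw) ?ltry.
have rge0 : 0 <= r by rewrite -lee_fin -phir.
move: phiw; rewrite phir lte_fin !fctE => rf.
have fw : f (w - w0) <= K * n by rewrite (le_trans (ler_norm _))// fK.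
have tr : t * r < f (w - w0) - t * e * n.
  rewrite -mulrA -ltr_pdivlMl// mulrBr mulKf ?gt_eqF//; exact: rf.
have ten : 0 <= t * e * n by apply: mulr_ge0 n0; apply: mulr_ge0; exact: ltW.
have rsn : r <= s * n.
  have : t * r <= (K + 1) * n by lra.
  by rewrite /t mulrAC ler_pdivrMr// -mulrA ler_pM2l ?addr_gt0// mulrC.
have rrho : r < rho by rewrite (le_lt_trans rsn)// mulrC -ltr_pdivlMr.
have [v Sv vw] := eb w r wrho rrho ltac:(by rewrite phir).
set m := `|w - v| in vw.
have m0 : 0 <= m := normr_ge0 _.
have mn : m <= n by rewrite -(ler_pM2l s0) (le_trans vw).
have vw0 : `|v - w0| <= n + m.
  by rewrite [leRHS]addrC (le_trans (ler_distD w v w0))// (distrC v w).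
have := dS v; rewrite -ball_normE /= distrC => /(_ ltac:(lra) Sv) fv.
have fwv : f (w - w0) = f (w - v) + f (v - w0).
  by have := df.1 1 (w - v) (v - w0); rewrite scale1r subrKA scale1r.
have fm : f (w - v) <= K * m by rewrite (le_trans (ler_norm _))// fK.
have e1nm : e1 * `|v - w0| <= t * e * n + m.
  rewrite (le_trans (ler_wpM2l (ltW e10) vw0))// mulrDr lerD//.
    by rewrite ler_wpM2r// ge_min lexx orbT.
  by rewrite -[leRHS]mul1r ler_wpM2r// ge_min lexx.
have : (K + 1) * m <= t * r.
  rewrite /t mulrAC ler_pdivlMr// -mulrA ler_pM2l ?addr_gt0//.
  by rewrite mulrC.
lra.
Qed.

(** * The merit function of the inclusion *)

Section Inclusion.
Context {R : realType} {P X Y : normedModType R}.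
Variables (F : P -> X -> set Y) (C : set Y).

Lemma merit_ge0 w : F w.1 w.2 !=set0 -> (0 <= merit F C w)%E.
Proof.
move=> [y Fy]; apply: le_trans (dist_ge0 y C) _.
by apply: ereal_sup_ubound; exists y.
Qed.

Lemma merit_eq0 w : closed C -> F w.1 w.2 !=set0 ->
  merit F C w = 0%E <-> sol F C w.1 w.2.
Proof.
move=> Ccl F0; split=> [m0 y Fy|FC].
  apply: dist_le0 => //.
  by move: Fy; apply: (merit_leP F C w 0).1; rewrite m0.
apply/eqP; rewrite eq_le merit_ge0// andbT; apply/merit_leP => y /FC Cy.
by apply: ereal_inf_lbound; exists y; rewrite // subrr normr0.
Qed.

(** A value of [F p x] far from [C] persists, up to a small displacement, as a
value at all points near [x]. *)
Lemma merit_lsc p : (forall x, lsc_at (F p) x) ->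
  lower_semicontinuous (fun x => merit F C (p, x)).
Proof.
move=> Flsc x a /ereal_sup_gt[_ [y Fy <-]] ay.
have [e e0 ey] : exists2 e, 0 < e & ((a + e)%:E < dist y C)%E.
  case: (dist y C) ay => [r||//].
    rewrite lte_fin => ar; exists ((r - a) / 2); first lra.
    by rewrite lte_fin; lra.
  by exists 1; rewrite // ltry.
exists [set z | F p z `&` ball y e !=set0].
  by apply: Flsc; [exact: ball_open|exists y; split=> //; exact: ballxx].
move=> z [y' [Fy']]; rewrite -ball_normE /= => yy'.
rewrite ltNge; apply/negP => /merit_leP/(_ _ Fy').
by move=> /dist_le_perturb => /(_ y e (ltW yy')); rewrite leNgt ey.
Qed.

End Inclusion.

(** The slope condition bears on the points within [a / s] of [x]: this is the
region that Ekeland's principle explores. *)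
Lemma sol_error_bound {R : realType} {P Y : normedModType R}
    {X : completeNormedModType R} (F : P -> X -> set Y) (C : set Y)
    (p : P) (x : X) (s a : R) :
  closed C -> convex_set C -> is_cone C -> (forall v, F p v !=set0) ->
  (forall v, lsc_at (F p) v) -> 0 < s ->
  (forall v, s * `|x - v| <= a -> ~ sol F C p v ->
     exists2 H, outer_prederivative (F p) v H & (s%:E < sigma C H)%E) ->
  (merit F C (p, x) <= a%:E)%E ->
  exists2 v, sol F C p v & s * `|x - v| <= a.
Proof.
move=> Ccl Ccv Cc F0 Flsc s0 slope xa.
have [v v0 va] : exists2 v, merit F C (p, v) = 0%E & s * `|x - v| <= a.
  apply: (@error_bound _ _ (fun v => merit F C (p, v))) => //.
  - by move=> v; apply: merit_ge0; exact: F0.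
  - exact: merit_lsc.
  move=> v r va r0 vr.
  have nsol : ~ sol F C p v.
    move=> /(merit_eq0 F C (p, v) Ccl (F0 v)).2; rewrite vr => -[] re0.
    by rewrite re0 ltxx in r0.
  have [H Hout sH] := slope v va nsol.
  have Fr y : F p v y -> (dist y C <= r%:E)%E.
    by apply: (merit_leP F C (p, v) r%:E).1; rewrite vr.
  have [w wv wle] :=
    outer_prederivative_decrease _ _ _ _ _ _ Ccv Cc Hout s0 sH r0 Fr.
  by exists w => //; apply/merit_leP.
by exists v => //; exact: (merit_eq0 F C (p, v) Ccl (F0 v)).1.
Qed.

(** * Coderivative of the solution mapping *)

Theorem proposition4p13 (R : realType) (P : normedModType R)
    (X : completeNormedModType R) (Y : normedModType R)
    (F : P -> X -> set Y) (C : set Y)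
    (C_closed : closed C) (C_convex : convex_set C) (C_cone : is_cone C)
    (C_int : C° !=set0)
    (F_nonempty : forall p x, F p x !=set0)
    (pbar : P) (xbar : X)
    (hi : sol F C pbar xbar)
    (hii : hausdorff_usc_at C (fun p => F p xbar) pbar)
    (hiii : exists2 delta1 : R, 0 < delta1 &
       forall p, closed_ball pbar delta1 p -> forall x, lsc_at (F p) x)
    (hiv : exists2 delta2 : R, 0 < delta2 &
       exists H : P -> X -> X -> set Y,
         (forall p x, closed_ball pbar delta2 p -> closed_ball xbar delta2 x ->
            outer_prederivative (F p) x (H p x)) /\
         (0 < ereal_inf [set sigma C (H w.1 w.2) |
                w in (closed_ball pbar delta2 `*` closed_ball xbar delta2)
                     `\` graph (sol F C)])%E) :
  exists zeta eta : R, [/\ 0 < zeta, 0 < eta &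
    forall (p : P) (x : X),
      (((closed_ball pbar zeta)° `*` (closed_ball xbar eta)°)
         `&` graph (sol F C)) (p, x) ->
      forall xs : X -> R^o, dual X xs ->
        frechet_coderivative (sol F C) p x xs =
        [set ps | dual P ps /\
           conic_hull (frechet_subdiff (merit F C) (p, x))
                      (dual_pair ps (- xs))]].

Proof.
have [d1 d10 Flsc] := hiii.
have [d2 d20 [H [Hout Hsig]]] := hiv.
have [s s0 ssig] : exists2 s : R, 0 < s & forall p x,
    closed_ball pbar d2 p -> closed_ball xbar d2 x -> ~ sol F C p x ->
    (s%:E < sigma C (H p x))%E.
  have [s s0 sI] : exists2 s : R, 0 < s & (s%:E <
      ereal_inf [set sigma C (H w.1 w.2) |
        w in (closed_ball pbar d2 `*` closed_ball xbar d2)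
             `\` graph (sol F C)])%E.
    move: Hsig; case: ereal_inf => [r||//]; last by exists 1; rewrite ?ltry.
    by rewrite lte_fin => r0; exists (r / 2); rewrite ?lte_fin; lra.
  exists s => // p x px xx nsol; apply: lt_le_trans sI _.
  by apply: ereal_inf_lbound; exists (p, x).
pose r := Num.min d1 d2.
have r0 : 0 < r by rewrite lt_min d10.
have rd1 : r <= d1 by rewrite ge_min lexx.
have rd2 : r <= d2 by rewrite ge_min lexx orbT.
have r20 : 0 < r / 2 by rewrite divr_gt0.
exists (r / 2), (r / 2); split=> // p x [[/= /interior_subset + /interior_subset]].
rewrite !closed_ballE// /closed_ball_ /= => pr xr solx xs _.
suff <- : frechet_normal (graph (sol F C)) (p, x) =
          conic_hull (frechet_subdiff (merit F C) (p, x)).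
  by [].
(* A point within [rho] of [(p, x)] has its second component within [3 r / 4] of
   [xbar], and a merit below [rho] keeps the search within [r / 4] of it: the
   search stays in the ball of radius [r] around [xbar]. *)
pose rho := Num.min (r / 4) (s * (r / 4)).
have r40 : 0 < r / 4 by rewrite divr_gt0.
have rho0 : 0 < rho by rewrite lt_min r40 mulr_gt0.
have rho4 : rho <= r / 4 by rewrite ge_min lexx.
have rhos : rho <= s * (r / 4) by rewrite ge_min lexx orbT.
apply: (@frechet_normal_error_bound _ _ _ _ _ s rho) => //.
- by move=> w; apply: merit_ge0.
- by move=> w; apply: (merit_eq0 F C w C_closed (F_nonempty _ _)).2.
move=> [p' x'] a; rewrite prod_normE /= gt_max => /andP[pp' xx'] arho ma.
have pball : `|pbar - p'| <= r.
  by have := ler_distD p pbar p'; rewrite (distrC p p'); lra.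
have [v solv va] : exists2 v, sol F C p' v & s * `|x' - v| <= a.
  apply: (sol_error_bound _ _ _ _ _ _ C_closed C_convex C_cone _ _ s0 _ ma) => //.
    move=> v; apply: Flsc; rewrite closed_ballE// /closed_ball_ /=.
    exact: le_trans pball rd1.
  move=> v va nsol.
  have x'v : `|x' - v| < r / 4.
    by rewrite -(ltr_pM2l s0) (le_lt_trans va)// (lt_le_trans arho).
  have p'in : closed_ball pbar d2 p'.
    by rewrite closed_ballE// /closed_ball_ /= (le_trans pball).
  have vin : closed_ball xbar d2 v.
    rewrite closed_ballE// /closed_ball_ /=.
    have := ler_distD x xbar v; have := ler_distD x' x v.
    by rewrite (distrC x x'); lra.
  by exists (H p' v); [exact: Hout|exact: ssig].
exists (p', v) => //; rewrite prod_normE /= subrr normr0.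
by rewrite max_r.
Qed.
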